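(* Let $\Sigma$ be the continuous-time control-affine system $\dot x=f(x)+Gu$, $y=h(x)+Ju$ described in the context. Suppose that $\Sigma$ satisfies the EID Hill-Moylan conditions (see context) with a continuously differentiable function $V:\mathcal{X}\to\mathbb{R}_{\ge0}$ that is strictly convex and with supply parameters $(Q,S,R)$ such that $Q\prec 0$. If $\Sigma$ is equilibrium-independent observable, then for every $\bar x\in\mathcal{E}_\Sigma$, with $\bar u=k_u(\bar x)$, the point $x=\bar x$ is a locally asymptotically stable equilibrium of the forced system $\dot x=f(x)+G\bar u$. Moreover, if $V$ is strongly convex, then $\bar x$ is globally asymptotically stable.
   Context: System: $\dot x(t)=f(x(t))+Gu(t)$, $y(t)=h(x(t))+Ju(t)$, with $x(t)\in\mathcal{X}=\mathbb{R}^n$, $u(t)\in\mathcal{U}=\mathbb{R}^m$, $y(t)\in\mathcal{Y}=\mathbb{R}^p$, $m,p\le n$. The maps $f:\mathcal{X}\to\mathbb{R}^n$, $h:\mathcal{X}\to\mathcal{Y}$ are sufficiently smooth that trajectories are forward complete for all initial conditions and all inputs $u(\cdot)\in\mathscr{L}_{2e}^m[0,\infty)$, with outputs in $\mathscr{L}_{2e}^p[0,\infty)$. $G\in\mathbb{R}^{n\times m}$ is constant with rank $m$; $J\in\mathbb{R}^{p\times m}$ is constant. Equilibria: $\mathcal{E}_\Sigma=\{\bar x\in\mathcal{X}: \exists\,\bar u\in\mathcal{U},\ f(\bar x)+G\bar u=0\}$. For $\bar x\in\mathcal{E}_\Sigma$ the unique equilibrium input and output are $\bar u=k_u(\bar x):=-(G^{\mathsf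 T}G)^{-1}G^{\mathsf T}f(\bar x)$ and $\bar y=k_y(\bar x):=h(\bar x)+Jk_u(\bar x)$. EID Hill-Moylan conditions with $V$ and $(Q,S,R)$ (where $Q=Q^{\mathsf T}$, $R=R^{\mathsf T}$, and $\begin{bmatrix}Q&S\\S^{\mathsf T}&R\end{bmatrix}$ is sign-indefinite): $V:\mathcal{X}\to\mathbb{R}_{\ge0}$ is continuously differentiable and convex, and there exist an integer $k>0$, $W\in\mathbb{R}^{k\times m}$ and $\ell:\mathcal{X}\times\mathcal{X}\to\mathbb{R}^k$ such that for all $(x,\bar x)\in\mathcal{X}\times\mathcal{E}_\Sigma$: $[\nabla V(x)-\nabla V(\bar x)]^{\mathsf T}[f(x)-f(\bar x)]=[h(x)-h(\bar x)]^{\mathsf T}Q[h(x)-h(\bar x)]-\|\ell(x,\bar x)\|_2^2$; $\frac12[\nabla V(x)-\nabla V(\bar x)]^{\mathsf T}G=[h(x)-h(\bar x)]^{\mathsf T}(QJ+S)-\ell(x,\bar x)^{\mathsf T}W$; $W^{\mathsf T}W=R+J^{\mathsf T}S+S^{\mathsf T}J+J^{\mathsf T}QJ$. Convexity: a differentiable $V$ is strictly convex if $[\nabla V(x)-\nabla V(z)]^{\mathsf T}(x-z)>0$ for all $x\ne z$, and strongly convex if for some $\mu>0$, $[\nabla V(x)-\nabla V(z)]^{\mathsf T}(x-z)\ge\mu\|x-z\|_2^2$ for all $x,z$. Equilibrium-independent observable: for every $\bar x\in\mathcal{E}_\Sigma$ with $\bar u=k_u(\bar x)$, $\bar y=k_y(\bar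 x)$, no trajectory of $\dot x=f(x)+G\bar u$ can remain within $\{x\in\mathcal{X}: h(x)+J\bar u=\bar y\}$ other than the equilibrium trajectory $x(t)=\bar x$. *)

(* Defs.v *)
From HB Require Import structures.
From mathcomp Require Import all_boot all_order all_algebra.
From mathcomp Require Import all_classical all_reals all_analysis.

Set Implicit Arguments.
Unset Strict Implicit.
Unset Printing Implicit Defensive.

Import Order.TTheory GRing.Theory Num.Theory.
Import numFieldNormedType.Exports.

Local Open Scope classical_set_scope.
Local Open Scope ring_scope.

Section Euclidean.
Context {K : realType}.

Definition dot {n : nat} (a b : 'cV[K]_n) : K := (a^T *m b) 0 0.

(* The library norm `|x| on matrices is the sup norm, hence this one. *)
Definition enorm {n : nat} (a : 'cV[K]_n) : K := Num.sqrt (dot a a).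

Definition symmetric_mx {n : nat} (A : 'M[K]_n) : Prop := A^T = A.

Definition negative_definite {n : nat} (A : 'M[K]_n) : Prop :=
  forall v : 'cV[K]_n, v != 0 -> dot v (A *m v) < 0.

Definition sign_indefinite {n : nat} (A : 'M[K]_n) : Prop :=
  (exists v : 'cV[K]_n, 0 < dot v (A *m v)) /\
  (exists w : 'cV[K]_n, dot w (A *m w) < 0).

End Euclidean.

Section ConvexFunctions.
Context {K : realType} {n : nat}.
Implicit Type V : 'cV[K]_n -> K.

Definition grad V (x : 'cV[K]_n) : 'cV[K]_n :=
  \col_i 'D_(delta_mx i 0) V x.

Definition continuously_differentiable V : Prop :=
  (forall x, differentiable V x) /\ continuous (grad V).

Definition convex_fun V : Prop :=
  convex_function [set: 'cV[K]_n] V.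

Definition strictly_convex V : Prop :=
  forall x z, x != z -> 0 < dot (grad V x - grad V z) (x - z).

Definition strongly_convex V : Prop :=
  exists2 mu : K, 0 < mu &
    forall x z, mu * enorm (x - z) ^+ 2 <= dot (grad V x - grad V z) (x - z).

End ConvexFunctions.

Section Signals.
Context {K : realType}.
Local Notation mu := (@lebesgue_measure K).

Definition L2e {m : nat} (u : K -> 'cV[K]_m) : Prop :=
  (forall i, measurable_fun `[(0 : K), +oo[ (fun t => u t i 0)) /\
  (forall T : K, 0 <= T ->
     (\int[mu]_(t in `[0%R, T]) ((enorm (u t) ^+ 2)%:E) < +oo)%E).

End Signals.

(* dx/dt = f x + G u,  y = h x + J u *)
Record system (K : realType) (n m p : nat) := System {
  drift : 'cV[K]_n -> 'cV[K]_n;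
  outmap : 'cV[K]_n -> 'cV[K]_p;
  inmx : 'M[K]_(n, m);
  feedmx : 'M[K]_(p, m) }.

Section Systems.
Context {K : realType} {n m p : nat}.
Variable Sigma : system K n m p.
Local Notation mu := (@lebesgue_measure K).
Local Notation f := (drift Sigma).
Local Notation h := (outmap Sigma).
Local Notation G := (inmx Sigma).
Local Notation J := (feedmx Sigma).

Definition vfield (x : 'cV[K]_n) (u : 'cV[K]_m) : 'cV[K]_n := f x + G *m u.

Definition output (x : 'cV[K]_n) (u : 'cV[K]_m) : 'cV[K]_p := h x + J *m u.

(* Caratheodory solutions on [0, +oo[ of dx/dt = f x + G u: inputs in L2e need
   not be continuous, so the equation is required in integrated form.  Values at
   negative times are irrelevant. *)
Definition trajectory (u : K -> 'cV[K]_m) (x : K -> 'cV[K]_n) : Prop :=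
  {within `[(0 : K), +oo[, continuous x} /\
  forall t : K, 0 <= t -> forall i,
    mu.-integrable `[0, t] (fun s => (vfield (x s) (u s) i 0)%:E) /\
    x t i 0 = x 0 i 0 + \int[mu]_(s in `[0, t]) vfield (x s) (u s) i 0.

Definition forward_complete : Prop :=
  forall (x0 : 'cV[K]_n) (u : K -> 'cV[K]_m), L2e u ->
    exists2 x, trajectory u x & x 0 = x0.

Definition outputs_L2e : Prop :=
  forall u x, L2e u -> trajectory u x -> L2e (fun t => output (x t) (u t)).

(* The regularity of f is local Lipschitz continuity, the usual one making
   trajectories unique; every continuously differentiable f has it. *)
Definition standing_assumptions : Prop :=
  [/\ [/\ (m <= n)%N, (p <= n)%N & \rank G = m],
      (forall x0 : 'cV[K]_n, exists2 U, nbhs x0 U & [lipschitz f x | x in U]),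
      continuous h, forward_complete & outputs_L2e].

Definition equilibria : set 'cV[K]_n := [set x | exists u, vfield x u = 0].

(* For G of full column rank, the only u that can solve vfield x u = 0. *)
Definition k_u (x : 'cV[K]_n) : 'cV[K]_m := - (invmx (G^T *m G) *m G^T *m f x).

Definition k_y (x : 'cV[K]_n) : 'cV[K]_p := output x (k_u x).

Definition supply_parameters
    (Q : 'M[K]_p) (S : 'M[K]_(p, m)) (R : 'M[K]_m) : Prop :=
  [/\ symmetric_mx Q, symmetric_mx R & sign_indefinite (block_mx Q S S^T R)].

Definition EID_Hill_Moylan (V : 'cV[K]_n -> K)
    (Q : 'M[K]_p) (S : 'M[K]_(p, m)) (R : 'M[K]_m) : Prop :=
  [/\ supply_parameters Q S R,
      forall x, 0 <= V x,
      continuously_differentiable V,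
      convex_fun V &
      exists (k : nat) (W : 'M[K]_(k, m)) (l : 'cV[K]_n -> 'cV[K]_n -> 'cV[K]_k),
      [/\ (0 < k)%N,
       forall x xb, equilibria xb ->
         dot (grad V x - grad V xb) (f x - f xb) =
           dot (h x - h xb) (Q *m (h x - h xb)) - enorm (l x xb) ^+ 2,
       forall x xb, equilibria xb ->
         2^-1 *: ((grad V x - grad V xb)^T *m G) =
           (h x - h xb)^T *m (Q *m J + S) - (l x xb)^T *m W &
       W^T *m W = R + J^T *m S + S^T *m J + J^T *m Q *m J]].

(* "Remaining in the set" means for all t >= 0. *)
Definition EI_observable : Prop :=
  forall xb, equilibria xb ->
  forall x, trajectory (cst (k_u xb)) x ->
    (forall t, 0 <= t -> output (x t) (k_u xb) = k_y xb) ->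
    forall t, 0 <= t -> x t = xb.

(* The notions below concern the forced system dx/dt = f x + G ub; under
   forward_complete it has trajectories from every initial state. *)

Definition lyapunov_stable (ub : 'cV[K]_m) (xb : 'cV[K]_n) : Prop :=
  forall e : K, 0 < e -> exists2 d : K, 0 < d &
    forall x, trajectory (cst ub) x -> enorm (x 0 - xb) < d ->
      forall t, 0 <= t -> enorm (x t - xb) < e.

Definition locally_attractive (ub : 'cV[K]_m) (xb : 'cV[K]_n) : Prop :=
  exists2 d : K, 0 < d &
    forall x, trajectory (cst ub) x -> enorm (x 0 - xb) < d ->
      x t @[t --> +oo] --> xb.

Definition globally_attractive (ub : 'cV[K]_m) (xb : 'cV[K]_n) : Prop :=
  forall x, trajectory (cst ub) x -> x t @[t --> +oo] --> xb.

Definition locally_asymptotically_stable (ub : 'cV[K]_m) (xb : 'cV[K]_n) : Prop :=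
  [/\ vfield xb ub = 0, lyapunov_stable ub xb & locally_attractive ub xb].

Definition globally_asymptotically_stable (ub : 'cV[K]_m) (xb : 'cV[K]_n) : Prop :=
  [/\ vfield xb ub = 0, lyapunov_stable ub xb & globally_attractive ub xb].

End Systems.

(* Main.v *)
(* Let D be the Bregman divergence of V at xb.  Along dx/dt = f x + G ub the first
   Hill-Moylan identity gives dD/dt = (h x - h xb)^T Q (h x - h xb) - |l|^2 <= 0.
   Strict convexity makes D positive away from xb, and convexity makes it grow at
   least linearly, so sublevel sets are bounded and xb is stable.  On the limit
   set of a trajectory D is constant; this set is invariant because solutions
   depend continuously on their initial state, so Q < 0 forces h x = h xb along
   every solution in it and observability leaves only xb.  Strict convexity thus
   already gives global attractivity. *)
Require Import Defs.
From HB Require Import structures.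
From mathcomp Require Import all_boot all_order all_algebra.
From mathcomp Require Import all_classical all_reals all_analysis.
From mathcomp Require Import ring lra.

Set Implicit Arguments.
Unset Strict Implicit.
Unset Printing Implicit Defensive.

Import Order.TTheory GRing.Theory Num.Theory.
Import numFieldNormedType.Exports.

Local Open Scope classical_set_scope.
Local Open Scope ring_scope.

(** * Euclidean inner product, comparison of norms, compactness *)

Section Euclid.
Context {K : realType}.

Lemma dotE n (a b : 'cV[K]_n) : dot a b = \sum_i a i 0 * b i 0.
Proof. by rewrite /dot mxE; apply: eq_bigr => i _; rewrite mxE. Qed.

Lemma dotDl n (a b c : 'cV[K]_n) : dot (a + b) c = dot a c + dot b c.
Proof. by rewrite /dot linearD mulmxDl mxE. Qed.

Lemma dotNl n (a b : 'cV[K]_n) : dot (- a) b = - dot a b.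
Proof. by rewrite /dot linearN mulNmx mxE. Qed.

Lemma dotBl n (a b c : 'cV[K]_n) : dot (a - b) c = dot a c - dot b c.
Proof. by rewrite dotDl dotNl. Qed.

Lemma dotZr n (k : K) (a b : 'cV[K]_n) : dot a (k *: b) = k * dot a b.
Proof. by rewrite /dot -scalemxAr mxE. Qed.

Lemma dot_ge0 n (a : 'cV[K]_n) : 0 <= dot a a.
Proof. by rewrite dotE sumr_ge0// => i _; rewrite -expr2 sqr_ge0. Qed.

Lemma dot_eq0 n (a : 'cV[K]_n) : dot a a = 0 -> a = 0.
Proof.
rewrite dotE => /eqP; rewrite psumr_eq0 => [/allP a0|i _]; last first.
  by rewrite -expr2 sqr_ge0.
apply/colP => i; have := a0 i; rewrite mem_index_enum mulf_eq0 orbb mxE.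
by move=> /(_ isT)/eqP.
Qed.

Lemma coord_le_norm n (a : 'cV[K]_n) i : `|a i 0| <= `|a|.
Proof.
rewrite [leRHS]/Num.norm/= mx_normrE.
exact: (le_bigmax _ (fun ij => `|a ij.1 ij.2|) (i, ord0)).
Qed.

Lemma norm_dot_le n (a b : 'cV[K]_n) : `|dot a b| <= n%:R * (`|a| * `|b|).
Proof.
rewrite dotE (le_trans (ler_norm_sum _ _ _))//.
have -> : n%:R * (`|a| * `|b|) = \sum_(i < n) (`|a| * `|b|).
  by rewrite sumr_const card_ord mulr_natl.
rewrite ler_sum// => i _.
by rewrite normrM ler_pM// coord_le_norm.
Qed.

Lemma norm_sqr_le_dot n (a : 'cV[K]_n) : `|a| ^+ 2 <= dot a a.
Proof.
have [/eqP a0|/mx_norm_neq0[[i j] /= aij]] := eqVneq (mx_norm a) 0.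
  by rewrite [`|a|](eqP a0) expr0n dot_ge0.
rewrite [`|a|]aij (ord1 j) dotE (bigD1 i)//= real_normK ?num_real// expr2.
by rewrite lerDl sumr_ge0// => k _; rewrite -expr2 sqr_ge0.
Qed.

(** Together with [enorm_le_norm], this passes between the Euclidean norm of the stability notions
    and the sup norm that carries the topology. *)
Lemma norm_le_enorm n (a : 'cV[K]_n) : `|a| <= enorm a.
Proof.
by rewrite -[leLHS]ger0_norm// -sqrtr_sqr ler_sqrt ?dot_ge0// norm_sqr_le_dot.
Qed.

Lemma enorm_le_norm n (a : 'cV[K]_n) : enorm a <= n%:R * `|a|.
Proof.
rewrite -[leRHS]ger0_norm ?mulr_ge0// -sqrtr_sqr /enorm ler_sqrt ?sqr_ge0//.
rewrite (le_trans (ler_norm _))// (le_trans (norm_dot_le _ _))// -expr2.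
rewrite exprMn ler_wpM2r ?sqr_ge0//; case: n a => [|n] _; first by rewrite expr0n.
by rewrite expr2 -natrM ler_nat leq_pmulr.
Qed.

(** Transposition is continuous and preserves the sup norm, so Heine-Borel for row vectors carries
    over. *)
Lemma bounded_closed_compact_cV n (A : set 'cV[K]_n) :
  bounded_set A -> closed A -> compact A.
Proof.
move=> [M [Mr bA]] clA.
have ctr p q : continuous (fun B : 'M[K]_(p, q) => B^T).
  move=> B U [P PB PU]; exists (fun i j => P j i) => [i j|N PN].
    by have := PB j i; rewrite mxE.
  by apply: PU => i j; rewrite mxE; exact: PN.
have -> : A = (fun B : 'rV[K]_n => B^T) @` ((fun B : 'rV[K]_n => B^T) @^-1` A).
  apply/seteqP; split=> [x Ax|_ [y Ay <-]//].
  by exists x^T; rewrite /= trmxK.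
apply: continuous_compact.
  by apply: continuous_subspaceT; exact: ctr.
apply: bounded_closed_compact; last first.
  by apply: preimage_closed => // x _; exact: ctr.
exists M; split=> // x Mx y /= /bA - /(_ _ Mx) /=.
rewrite /Num.norm/= !mx_normrE => yx; rewrite (le_trans _ yx)//.
apply/bigmax_leP; split=> [|[i j] _ /=]; first exact: bigmax_ge_id.
have := le_bigmax 0 (fun ij : 'I_n * 'I_1 => `|y^T ij.1 ij.2|) (j, i).
by rewrite /= mxE.
Qed.

Lemma continuous_dist n (b : 'cV[K]_n) : continuous (fun a : 'cV[K]_n => `|a - b|).
Proof.
move=> a; have ca : (fun a => a - b) @ a --> a - b.
  by apply: (@cvgB _ _ _ (nbhs a)); [exact: cvg_id|exact: cvg_cst].
exact: cvg_norm ca.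
Qed.

Lemma compact_closed_ball_cV n (b : 'cV[K]_n) (r : K) :
  compact [set a | `|a - b| <= r].
Proof.
apply: bounded_closed_compact_cV.
  exists (r + `|b|); split; rewrite ?num_real// => M /ltW rM a /= ar.
  have := ler_normD (a - b) b; rewrite subrK => /le_trans; apply.
  by rewrite (le_trans _ rM)// lerD2r.
apply: (@preimage_closed _ _ (fun a : 'cV[K]_n => `|a - b|) [set s | s <= r]);
  last exact: closed_le.
by move=> a _; exact: continuous_dist.
Qed.

End Euclid.

(** * Derivatives along curves, monotonicity, Lipschitz bounds *)

Section Calculus.
Context {K : realType}.

Lemma cvg_dot n (T : Type) (F : set_system T) {FF : Filter F}
    (a b : T -> 'cV[K]_n) (a0 b0 : 'cV[K]_n) :
  a @ F --> a0 -> b @ F --> b0 -> dot (a s) (b s) @[s --> F] --> dot a0 b0.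
Proof.
move=> ca cb; rewrite dotE; under eq_cvg do rewrite dotE.
apply: cvg_big => [|i _]; first exact: add_continuous.
apply: cvgM.
  exact: (cvg_comp _ _ ca (@coord_continuous _ _ _ i 0 a0)).
exact: (cvg_comp _ _ cb (@coord_continuous _ _ _ i 0 b0)).
Qed.

Lemma continuous_dot_sqr n (c : 'cV[K]_n) :
  continuous (fun a : 'cV[K]_n => dot (a - c) (a - c)).
Proof.
move=> a; have ca : (fun a => a - c) @ a --> a - c.
  by apply: (@cvgB _ _ _ (nbhs a)); [exact: cvg_id|exact: cvg_cst].
exact: (@cvg_dot _ _ (nbhs a)).
Qed.

Lemma is_derive_dot n (a b : K -> 'cV[K]_n) da db (t : K) :
  is_derive t 1 a da -> is_derive t 1 b db ->
  is_derive t 1 (fun s => dot (a s) (b s)) (dot da (b t) + dot (a t) db).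
Proof.
move=> Da Db.
have coord (c : K -> 'cV[K]_n) dc : is_derive t 1 c dc ->
    forall i, is_derive t 1 (fun s => c s i 0) (dc i 0).
  move=> [dvc <-] i; split; first exact: (derivable_mxP _ _ _).1 dvc i 0.
  by rewrite derive_mx// mxE.
have -> : (fun s => dot (a s) (b s)) =
    \sum_(i < n) ((fun s => a s i 0) * (fun s => b s i 0)).
  by apply/funext => s; rewrite dotE fct_sumE.
have -> : dot da (b t) + dot (a t) db =
    \sum_(i < n) (a t i 0 *: db i 0 + b t i 0 *: da i 0).
  rewrite !dotE -big_split/=; apply: eq_bigr => i _.
  by rewrite addrC /GRing.scale/= [X in _ + X]mulrC.
by apply: is_derive_sum => i; apply: is_deriveM; exact: coord.
Qed.

Lemma diff_grad n (V : 'cV[K]_n -> K) x v :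
  differentiable V x -> 'd V x v = dot (grad V x) v.
Proof.
move=> dV; rewrite dotE {1}[v]matrix_sum_delta exchange_big big_ord1 linear_sum.
by apply: eq_bigr => i _; rewrite linearZ mxE deriveE// mulrC.
Qed.

Lemma is_derive_comp_grad n (V : 'cV[K]_n -> K) (x : K -> 'cV[K]_n) v (t : K) :
  differentiable V (x t) -> is_derive t 1 x v ->
  is_derive t 1 (V \o x) (dot (grad V (x t)) v).
Proof.
move=> dV [/derivable1_diffP dx xv].
have dVx := differentiable_comp dx dV; split; first exact/derivable1_diffP.
by rewrite deriveE// diff_comp//= -[X in 'd V _ X](deriveE _ dx) xv diff_grad.
Qed.

(** Right continuity suffices at 0, where functions of a solution on the half-line need not have a
    two-sided derivative. *)
Lemma derive_le0_nincr (g dg : K -> K) :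
  g @ 0^'+ --> g 0 ->
  (forall t : K, 0 < t -> is_derive t 1 g (dg t)) ->
  (forall t : K, 0 < t -> dg t <= 0) ->
  forall s t : K, 0 <= s -> s <= t -> g t <= g s.
Proof.
move=> cg Dg dg0; apply: ler0_derive1_nincry => [t|t|].
- by rewrite in_itv/= andbT => /Dg[].
- rewrite in_itv/= andbT => t0; rewrite derive1E.
  by have [_ ->] := Dg _ t0; exact: dg0.
- apply/continuous_within_itvcyP; split=> // t; rewrite in_itv/= andbT => /Dg[+ _].
  by move/derivable1_diffP/differentiable_continuous.
Qed.

Lemma locally_lipschitz_continuous (U W : normedModType K) (f : U -> W) :
  (forall x : U, exists2 A : set U, nbhs x A & [lipschitz f z | z in A]) ->
  continuous f.
Proof.
move=> lipf x; have [A nA [M0 [_ /(_ (M0 + 1))]]] := lipf x.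
rewrite ltrDl ltr01 => /(_ isT) lipA; set M := M0 + 1 in lipA.
(* [M] may be zero or negative; [|M| + 1] dominates it and can be divided by. *)
have M1 : 0 < `|M| + 1 by rewrite ltr_wpDl.
apply/cvgrPdist_lt => e e0; near=> z.
rewrite (@le_lt_trans _ _ ((`|M| + 1) * `|x - z|))//.
  apply: (@le_trans _ _ (M * `|x - z|)).
    apply: (lipA (x, z)); split => /=; first exact: nbhs_singleton.
    by near: z.
  by rewrite ler_wpM2r// (le_trans (ler_norm _))// lerDl.
rewrite mulrC -ltr_pdivlMr//; near: z.
have := nbhsx_ballx x _ (divr_gt0 e0 M1).
by rewrite -ball_normE.
Unshelve. all: by end_near. Qed.

(** Compactness is applied to the square of [C], with the constant [k] tending to infinity: it is
    enough that each pair has a neighbourhood on which every large [k] works. *)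
Lemma lipschitz_on_compact (U W : normedModType K) (f : U -> W) (C : set U) :
  (forall x : U, exists2 A : set U, nbhs x A & [lipschitz f z | z in A]) ->
  compact C ->
  exists2 k, 0 <= k & forall x y, C x -> C y -> `|f x - f y| <= k * `|x - y|.
Proof.
move=> lipf cC.
have cf := locally_lipschitz_continuous lipf.
have /compact_near_coveringP/(_ K +oo
  (fun k p => `|f p.1 - f p.2| <= k * `|p.1 - p.2|) _) :=
  compact_setX cC cC.
case => [[x y] /= _|M0 [_ H]]; last first.
  exists `|M0 + 1| => // x y Cx Cy.
  rewrite (@le_trans _ _ ((M0 + 1) * `|x - y|))// ?ler_wpM2r ?ler_norm//.
  by apply: (H (M0 + 1) _ (x, y)) => //; rewrite ltrDl.
(* Near the diagonal the local constants work; away from it, [f] is bounded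
   while [`|x - y|] is bounded below. *)
have [<-|xy] := eqVneq x y.
  have [A nA [M0 [M0r lipA]]] := lipf x.
  exists (A `*` A, [set k | M0 < k]) => /=.
    by split; [exists (A, A)|exists M0].
  by move=> [p k] [/= Ap /lipA]; exact.
have d0 : 0 < `|x - y| / 4 by rewrite divr_gt0// normr_gt0 subr_eq0.
pose P z := [set w | `|z - w| < `|x - y| / 4 /\ `|f z - f w| < 1].
have nP z : nbhs z (P z).
  near=> w; split; near: w.
    by have := nbhsx_ballx z _ d0; rewrite -ball_normE.
  by move/cvgrPdist_lt : (cf z) => /(_ 1 ltr01).
(* Each of the two points changes its image by less than 1, hence the 2. *)
pose B := `|f x - f y| + 2.
exists (P x `*` P y, [set k | B / (`|x - y| / 4) < k]) => /=.
  by split; [exists (P x, P y)|exists (B / (`|x - y| / 4)); rewrite num_real].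
move=> [[z w] k] [/= [[xz fxz] [yw fyw]] kB].
have zw : `|x - y| / 4 <= `|z - w|.
  have : `|x - y| <= `|x - z| + `|z - w| + `|y - w|.
    rewrite (distrC y) (le_trans _ (lerD (ler_normD _ _) (lexx _)))//.
    by rewrite (le_trans _ (ler_normD _ _))// !(addrA, subrK).
  by lra.
have fzw : `|f z - f w| <= B.
  have : `|f z - f w| <= `|f x - f z| + `|f x - f y| + `|f y - f w|.
    rewrite (distrC (f x) (f z)) (le_trans _ (lerD (ler_normD _ _) (lexx _)))//.
    by rewrite (le_trans _ (ler_normD _ _))// !(addrA, subrK).
  by rewrite /B; lra.
rewrite (le_trans fzw)//; move: kB; rewrite ltr_pdivrMr// => /ltW kB.
rewrite (le_trans kB)// ler_wpM2l//.
have : 0 <= B by rewrite addr_ge0.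
by have := d0; nra.
Unshelve. all: by end_near. Qed.

End Calculus.

(** * Solutions of autonomous equations, limit sets, LaSalle's principle *)

Section Solutions.
Context {K : realType} {n : nat}.
Implicit Types (F : 'cV[K]_n -> 'cV[K]_n) (x z : K -> 'cV[K]_n).

(** Values at negative times are arbitrary, so only a right limit is required at 0. *)
Definition solves F x : Prop :=
  x @ 0^'+ --> x 0 /\ forall t : K, 0 < t -> is_derive t 1 x (F (x t)).

Lemma solves_shift F x (T : K) : 0 <= T -> solves F x ->
  solves F (fun s => x (T + s)).
Proof.
(* A shift by 0 has only the right limit at its starting point; for [T > 0] differentiability at [T]
   gives continuity there. *)
rewrite le_eqVlt => /predU1P[<-|T0] xs.
  by under eq_fun do rewrite add0r.
have [_ Dx] := xs; split=> [|t t0].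
  have [/derivable1_diffP/differentiable_continuous cx _] := Dx _ T0.
  rewrite addr0; apply: (cvg_comp (+%R T) x _ cx).
  apply: cvg_at_right_filter; rewrite -[X in _ --> X]addr0.
  by apply: cvgD; [exact: cvg_cst|exact: cvg_id].
have [/derivable1_diffP dx xv] := Dx _ (addr_gt0 T0 t0).
have [/derivable1_diffP dT DT] := is_derive_shift t 1 T.
have -> : (fun s => x (T + s)) = x \o shift T.
  by apply/funext => s /=; rewrite addrC.
rewrite addrC in dx xv *.
have dxT := differentiable_comp dT dx; split; first exact/derivable1_diffP.
rewrite deriveE// diff_comp//= -[X in 'd x _ X](deriveE _ dT) DT.
by rewrite -deriveE.
Qed.

(* The factor [n] in the exponent is the cost of bounding [dot] by the sup norm. *)
Lemma gronwall_dist F (C : set 'cV[K]_n) (k : K) x z :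
  0 <= k -> (forall a b, C a -> C b -> `|F a - F b| <= k * `|a - b|) ->
  solves F x -> solves F z ->
  (forall t, 0 <= t -> C (x t)) -> (forall t, 0 <= t -> C (z t)) ->
  forall s, 0 <= s ->
    dot (x s - z s) (x s - z s) <=
    dot (x 0 - z 0) (x 0 - z 0) * expR (2 * n%:R * k * s).
Proof.
move=> k0 lipF [cx Dx] [cz Dz] Cx Cz s s0.
pose w s := dot (x s - z s) (x s - z s).
set c := 2 * n%:R * k.
pose dw s := dot (F (x s) - F (z s)) (x s - z s) +
  dot (x s - z s) (F (x s) - F (z s)).
have Dw (t : K) : 0 < t -> is_derive t 1 w (dw t).
  move=> t0; have Dxz := is_deriveB (Dx _ t0) (Dz _ t0).
  exact: (is_derive_dot Dxz Dxz).
have De (t : K) : is_derive t 1 (fun s => expR (- c * s)) (- c * expR (- c * t)).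
  rewrite mulrC; apply: (@is_derive1_comp _ expR).
  have := is_deriveZ (- c) (is_derive_id t 1); rewrite /GRing.scale/= mulr1; exact.
(* The integrating factor turns the inequality [dw <= c * w] into monotonicity of [g]. *)
pose g := w * (fun s => expR (- c * s)).
have : g s <= g 0.
  apply: (@derive_le0_nincr _ _
    (fun t => w t *: (- c * expR (- c * t)) + expR (- c * t) *: dw t)) => // [|t t0|t t0].
  - apply: cvgM; first by apply: cvg_dot; exact: cvgB.
    apply: cvg_at_right_filter; have [/derivable1_diffP + _] := De 0.
    exact: differentiable_continuous.
  - by apply: is_deriveM; exact: Dw.
  - rewrite /GRing.scale/=.
    have -> : w t * (- c * expR (- c * t)) + expR (- c * t) * dw t =
      expR (- c * t) * (dw t - c * w t) by ring.
    rewrite mulr_ge0_le0 ?expR_ge0// subr_le0.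
    have lip := lipF _ _ (Cx _ (ltW t0)) (Cz _ (ltW t0)).
    have dist : `|F (x t) - F (z t)| * `|x t - z t| <= k * w t.
      rewrite (le_trans (ler_wpM2r _ lip))// -mulrA -expr2 ler_wpM2l//.
      exact: norm_sqr_le_dot.
    have -> : c * w t = n%:R * (k * w t) + n%:R * (k * w t) by rewrite /c; ring.
    rewrite lerD// (le_trans (ler_norm _))// (le_trans (norm_dot_le _ _))//.
      by rewrite ler_wpM2l.
    by rewrite (mulrC `|x t - z t|) ler_wpM2l.
rewrite /g /= !mulrfctE mulr0 expR0 mulr1 mulNr expRN.
by rewrite ler_pdivrMr ?expR_gt0.
Qed.

(** At arbitrarily late times [t] the point [x t] is close to [z 0]; the Gronwall bound over the
    fixed duration [s] then keeps [x (t + s)] close to [z s]. *)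
Lemma omega_limit_invariant F (C : set 'cV[K]_n) (k : K) x z :
  0 <= k -> (forall a b, C a -> C b -> `|F a - F b| <= k * `|a - b|) ->
  solves F x -> solves F z ->
  (forall t, 0 <= t -> C (x t)) -> (forall t, 0 <= t -> C (z t)) ->
  cluster (x @ +oo) (z 0) -> forall s, 0 <= s -> cluster (x @ +oo) (z s).
Proof.
move=> k0 lipF xs zs Cx Cz clz0 s s0 A B [M [_ MA]] /nbhs_ballP[e /= e0 eB].
set E := expR (2 * n%:R * k * s).
(* Small enough that growth by the factor [E] leaves the squared distance below [e ^+ 2]. *)
pose near_z0 := [set a | dot (a - z 0) (a - z 0) * E < e ^+ 2].
have nbhs_z0 : nbhs (z 0) near_z0.
  have := @cvgM _ _ (nbhs (z 0)) _ _ _ _ _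
    (@continuous_dot_sqr K n (z 0) (z 0)) (cvg_cst E).
  rewrite subrr dotE big1 ?mul0r => [|i _]; last by rewrite mxE mul0r.
  have FF : Filter (nbhs (z 0)) by exact: nbhs_filter.
  move=> /(_ FF FF) cv; have := cvgr_lt _ cv (e ^+ 2); apply; exact: exprn_gt0.
have [|a [/= [t Mt <-] xtz]] :=
  clz0 (x @` [set t | Num.max M 0 < t]) near_z0 _ nbhs_z0.
  exists (Num.max M 0); split; first by rewrite num_real.
  by move=> t Mt; exists t.
have /andP[tM t0] : (M < t) && (0 < t) by rewrite -gt_max.
exists (x (t + s)); split; first by apply: MA; rewrite ltr_wpDr.
apply: eB; rewrite -ball_normE/= distrC.
have ts u : 0 <= u -> C (x (t + u)) by move=> u0; apply: Cx; rewrite addr_ge0// ltW.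
have := gronwall_dist k0 lipF (solves_shift (ltW t0) xs) zs ts Cz s0.
rewrite addr0 => /le_lt_trans /(_ xtz) d.
rewrite -(ltr_pXn2r (n := 2)) ?nnegrE ?(ltW e0)//.
by rewrite (le_lt_trans (norm_sqr_le_dot _)).
Qed.

(** [W] converges along [x], so it takes a single value on the limit set. By invariance it is
    constant along a solution issued from a limit point, and the last hypothesis then identifies
    that point with [p0]. In a compact set, a unique cluster point is the limit. *)
Lemma lasalle F (C : set 'cV[K]_n) (k : K) (W : 'cV[K]_n -> K) (p0 : 'cV[K]_n) x :
  compact C -> nbhs p0 C ->
  0 <= k -> (forall a b, C a -> C b -> `|F a - F b| <= k * `|a - b|) ->
  continuous W -> (forall a, 0 <= W a) ->
  solves F x -> (forall t, 0 <= t -> C (x t)) ->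
  (forall s t, 0 <= s -> s <= t -> W (x t) <= W (x s)) ->
  (forall p, W p <= W (x 0) -> exists z,
    [/\ solves F z, z 0 = p, forall t, 0 <= t -> C (z t) &
        (forall t, 0 <= t -> W (z t) = W p) -> p = p0]) ->
  x t @[t --> +oo] --> p0.
Proof.
move=> cC Cp0 k0 lipF cW W0 xs Cx Wx stay.
have [c Wc] : exists c : K, W (x t) @[t --> +oo] --> c.
  (* Clamping time at 0 makes [g] monotone on the whole line; the sign makes it nondecreasing. *)
  pose g t := - W (x (Num.max t 0)).
  have ndg : {homo g : s t / s <= t}.
    move=> s t st; rewrite lerN2; apply: Wx; first by rewrite le_max lexx orbT.
    by rewrite ge_max !le_max lexx st orbT.
  have ubg : has_ubound (range g) by exists 0 => _ [t _ <-]; rewrite oppr_le0.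
  exists (- sup (range g)); have /cvgN := nondecreasing_cvgr ndg ubg.
  apply: cvg_trans; apply: near_eq_cvg; near=> t.
  by rewrite /g /= opprK max_l//; near: t; exact: nbhs_pinfty_ge.
have clW p : cluster (x @ +oo) p -> W p = c.
  move=> clp; apply/esym; apply: (@norm_hausdorff _ K) => A B /Wc xA /(cW p) pB.
  by have [a [Aa Ba]] := clp (W @^-1` A) _ xA pB; exists (W a).
have clE p : cluster (x @ +oo) p -> p = p0.
  move=> clp; have Wp : W p <= W (x 0).
    rewrite (clW _ clp) -(cvg_lim _ Wc)//; apply: limr_le.
      by apply/cvg_ex; exists c.
    by near=> t; apply: Wx => //; near: t; exact: nbhs_pinfty_ge.
  have [z [zs zp Cz]] := stay _ Wp; apply => t t0.
  rewrite (clW _ clp); apply: clW; apply: (omega_limit_invariant k0 lipF xs zs) => //.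
  by rewrite zp.
have xC : (x @ +oo) C.
  by exists 0; split; rewrite ?real0// => t t0; exact/Cx/ltW.
have PF : ProperFilter (x @ +oo) by exact: fmap_proper_filter.
apply: (compact_cluster_set1 (@norm_hausdorff _ 'cV[K]_n) cC Cp0 PF xC).
apply/seteqP; split=> [p /clE//|_ ->].
by have [p [_ clp]] := cC _ _ xC; rewrite -(clE _ clp).
Unshelve. all: by end_near.
Qed.

End Solutions.

(** * The Bregman divergence as a Lyapunov function *)

Section Bregman.
Context {K : realType} {n : nat}.
Implicit Types (V : 'cV[K]_n -> K) (b a : 'cV[K]_n).

(** Its gradient in [a] is [grad V a - grad V b], the vector of the Hill-Moylan identities, so it
    acts as storage function relative to the equilibrium [b]. *)
Definition bregman V b a : K := V a - V b - dot (grad V b) (a - b).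

Lemma bregmanxx V b : bregman V b b = 0.
Proof.
by rewrite /bregman !subrr dotE big1 ?subr0// => i _; rewrite [X in _ * X]mxE mulr0.
Qed.

Lemma is_derive_bregman V b (x : K -> 'cV[K]_n) v (t : K) :
  differentiable V (x t) -> is_derive t 1 x v ->
  is_derive t 1 (bregman V b \o x) (dot (grad V (x t) - grad V b) v).
Proof.
move=> dV Dx.
have DVx := is_derive_comp_grad dV Dx.
have Dl := is_derive_dot (is_derive_cst (grad V b) t 1)
  (is_deriveB Dx (is_derive_cst b t 1)).
have := is_deriveB (is_deriveB DVx (is_derive_cst (V b) t 1)) Dl.
rewrite !subr0 dotBl.
have -> : dot (0 : 'cV[K]_n) (x t - b) = 0.
  by rewrite dotE big1// => i _; rewrite mxE mul0r.
by rewrite add0r.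
Qed.

Lemma continuous_bregman V b :
  (forall a, differentiable V a) -> continuous (bregman V b).
Proof.
move=> dV a; apply: (@cvgB _ _ _ (nbhs a)).
  apply: (@cvgB _ _ _ (nbhs a)); last exact: cvg_cst.
  exact: differentiable_continuous.
apply: (@cvg_dot _ _ _ (nbhs a)); first exact: cvg_cst.
by apply: (@cvgB _ _ _ (nbhs a)); [exact: cvg_id|exact: cvg_cst].
Qed.

(** By the mean value theorem on the segment from [b] to [a], the divergence is its derivative at
    some [c] in []0, 1[]; multiplied by [c], this is the pairing that strict convexity makes
    positive. *)
Lemma bregman_gt0 V b a : (forall a, differentiable V a) ->
  strictly_convex V -> a != b -> 0 < bregman V b a.
Proof.
move=> dV Vconv ab; pose r (t : K) := t *: (a - b) + b.
have Dr (t : K) : is_derive t 1 r (a - b).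
  have dr : derivable (fun t : K => t *: (a - b)) t 1 by apply/derivable1_diffP.
  have Dl : is_derive t 1 (fun t : K => t *: (a - b)) (a - b).
    split=> //; rewrite deriveE; last exact/derivable1_diffP.
    by rewrite diff_val scale1r.
  by have := is_deriveD Dl (is_derive_cst b t 1); rewrite addr0.
have Dphi (t : K) := is_derive_bregman b (dV (r t)) (Dr t).
have [|c] := @MVT K (bregman V b \o r) _ _ _ ltr01 (fun t _ => Dphi t).
  apply: derivable_within_continuous => t _; by have [] := Dphi t.
rewrite in_itv/= => /andP[c0 c1].
rewrite subr0 mulr1 /r /= scale1r subrK scale0r add0r bregmanxx subr0 => ->.
have cb : c *: (a - b) + b != b.
  by rewrite -subr_eq0 addrK scaler_eq0 (gt_eqF c0) subr_eq0.
by have := Vconv _ _ cb; rewrite addrK dotZr pmulr_rgt0.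
Qed.

Lemma bregman_ge0 V b a : (forall a, differentiable V a) ->
  strictly_convex V -> 0 <= bregman V b a.
Proof.
move=> dV Vconv; have [->|ab] := eqVneq a b; first by rewrite bregmanxx.
exact/ltW/bregman_gt0.
Qed.

(** The divergence differs from [V] by an affine function, so it inherits convexity, and it vanishes
    at [b]. *)
Lemma bregman_scale V b a (t : K) : convex_fun V -> 0 <= t <= 1 ->
  bregman V b (t *: (a - b) + b) <= t * bregman V b a.
Proof.
move=> Vconv t01.
have {}Vconv : V (t *: a + (1 - t) *: b) <= t * V a + (1 - t) * V b.
  have := Vconv (Itv01 (andP t01).1 (andP t01).2) a b.
  by rewrite !inE; exact.
have rayE : t *: a + (1 - t) *: b = t *: (a - b) + b.
  by rewrite scalerBl scale1r scalerBr addrA [in RHS]addrAC.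
by rewrite /bregman addrK dotZr; rewrite rayE in Vconv; lra.
Qed.

(* Convexity along rays propagates the minimum over the sphere of radius [e]. *)
Lemma bregman_growth V b (e : K) : (forall a, differentiable V a) ->
  convex_fun V -> strictly_convex V -> 0 < e ->
  exists2 r : K, 0 < r & forall a, e <= `|a - b| -> r * `|a - b| <= bregman V b a.
Proof.
move=> dV Vc Vsc e0.
pose S := [set a | `|a - b| = e].
have scale a : e <= `|a - b| -> S ((e / `|a - b|) *: (a - b) + b) /\
    bregman V b ((e / `|a - b|) *: (a - b) + b) * `|a - b| <= e * bregman V b a.
  move=> ea; have ab0 : 0 < `|a - b| by exact: lt_le_trans ea.
  split.
    by rewrite /S /= addrK normrZ ger0_norm ?divr_ge0 ?ltW// divfK ?gt_eqF.
  rewrite -ler_pdivlMr// mulrAC bregman_scale//.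
  by rewrite ler_pdivrMr// mul1r ea divr_ge0// ltW.
(* In dimension 0 the sphere is empty; no point is then at distance [e] or more, and any rate will
   do. *)
have [[a0 Sa0]|S0] := pselect (S !=set0); last first.
  exists 1 => // a /scale[Sa _]; exfalso; apply: S0.
  by eexists; exact: Sa.
have clS : closed S.
  apply: (@preimage_closed _ _ (fun a : 'cV[K]_n => `|a - b|) [set e]);
    last exact: closed_eq.
  by move=> a _; exact: continuous_dist.
have cS : compact S.
  apply: subclosed_compact clS (@compact_closed_ball_cV _ _ b e) _ => a Sa.
  by rewrite /= Sa.
have [c Sc cmin] := @compact_EVT_min _ K (bregman V b) S (ex_intro _ a0 Sa0) cS
  (continuous_subspaceT (@continuous_bregman V b dV)).
have c0 : 0 < bregman V b c.
  apply: bregman_gt0 => //; move: Sc; rewrite inE /S /= => cb.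
  by rewrite -subr_eq0 -normr_eq0 cb gt_eqF.
exists (bregman V b c / e); first by rewrite divr_gt0.
move=> a /scale[Sa sa]; rewrite mulrAC ler_pdivrMr// [leRHS]mulrC.
by rewrite (le_trans _ sa)// ler_wpM2r// cmin// inE.
Qed.

End Bregman.

(** * Trajectories under constant input, and the equilibrium input *)

Section EquilibriumStability.
Context {K : realType} {n m p : nat}.
Variable Sigma : system K n m p.
Local Notation mu := (@lebesgue_measure K).

(** Under a constant input the integrand is continuous along the trajectory, so the fundamental
    theorem of calculus upgrades the integral equation to a derivative at positive times. *)
Lemma trajectory_solves (u : 'cV[K]_m) (x : K -> 'cV[K]_n) :
  continuous (drift Sigma) -> trajectory Sigma (cst u) x ->
  solves (vfield Sigma ^~ u) x.
Proof.
move=> cf [cx Ix]; have [cx_oo cx0] := (continuous_within_itvcyP 0 x).1 cx.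
split=> // t t0.
have cxt : {for t, continuous x} by apply: cx_oo; rewrite in_itv/= t0.
have cFx i : {for t, continuous (fun s => vfield Sigma (x s) u i 0)}.
  have cF : continuous (fun a => vfield Sigma a u).
    by move=> a; apply: (@cvgD _ _ _ (nbhs a)); [exact: cf|exact: cvg_cst].
  apply: (@continuous_comp _ _ _ (fun s => vfield Sigma (x s) u) (fun M => M i 0)).
    by apply: (@continuous_comp _ _ _ x (fun a => vfield Sigma a u)); [|exact: cF].
  exact: coord_continuous.
have Dx i : is_derive t 1 (fun s => x s i 0) (vfield Sigma (x t) u i 0).
  pose I s := \int[mu]_(r in `[0, s]) vfield Sigma (x r) u i 0.
  have [dI DI] : derivable I t 1 /\ derive1 I t = vfield Sigma (x t) u i 0.
    (* Any right end beyond [t] puts [t] inside the interval of integration. *)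
    have tt1 : t < t + 1 by rewrite ltrDl.
    apply: (continuous_FTC1_closed tt1) => //.
    exact: (Ix _ (ltW (lt_trans t0 tt1)) i).1.
  apply: (@near_eq_is_derive _ _ _ (cst (x 0 i 0) + I)).
    near=> s; rewrite [RHS](Ix s _ i).2//.
    rewrite -oppr_le0 ltW//; near: s.
    by apply: Nlt_nbhsl; rewrite oppr_lt0.
  have DIt : is_derive t 1 I (vfield Sigma (x t) u i 0).
    by split; [exact: dI|rewrite -derive1E DI].
  by have := is_deriveD (is_derive_cst (x 0 i 0) t 1) DIt; rewrite add0r.
have dx : derivable x t 1.
  by apply/derivable_mxP => i j; rewrite (ord1 j); have [] := Dx i.
split=> //; rewrite derive_mx//; apply/colP => i; rewrite mxE.
by have [_ ->] := Dx i.
Unshelve. all: by end_near. Qed.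

(** If [v *m (G^T *m G) = 0], then [G *m v^T] has zero Euclidean norm, and full column rank forces
    [v = 0]. *)
Lemma gram_unitmx (G : 'M[K]_(n, m)) : \rank G = m -> G^T *m G \in unitmx.
Proof.
move=> rG; rewrite -row_free_unit -kermx_eq0.
apply/eqP/row_matrixP => i; rewrite row0.
set v := row i _.
have vGG : v *m (G^T *m G) = 0 by apply: sub_kermxP; exact: row_sub.
have Gv0 : G *m v^T = 0.
  apply: dot_eq0; rewrite /dot trmx_mul trmxK mulmxA.
  by rewrite -[v *m _ *m G]mulmxA vGG mul0mx mxE.
have GT : row_free G^T by rewrite /row_free mxrank_tr rG.
apply: (row_free_inj GT); rewrite mul0mx.
by rewrite -[LHS]trmxK trmx_mul trmxK Gv0 trmx0.
Qed.

Lemma vfield_k_u xb : \rank (inmx Sigma) = m -> equilibria Sigma xb ->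
  vfield Sigma xb (k_u Sigma xb) = 0.
Proof.
move=> rG [u u0]; suff -> : k_u Sigma xb = u by [].
(* The left inverse of the input matrix used in [k_u] recovers [u] from this equation. *)
have fE : drift Sigma xb = - (inmx Sigma *m u).
  by apply/eqP; rewrite -addr_eq0; apply/eqP.
rewrite /k_u fE mulmxN opprK mulmxA -[invmx _ *m _ *m _]mulmxA mulVmx ?mul1mx//.
exact: gram_unitmx.
Qed.

Lemma L2e_cst (u : 'cV[K]_m) : L2e (cst u).
Proof.
split=> [i|T T0]; first exact: measurable_cst.
rewrite [X in (X < _)%E](_ : _ = (enorm u ^+ 2)%:E * mu `[0%R, T])%E; last first.
  by rewrite -integral_cst.
rewrite lebesgue_measure_itv/= lte_fin.
by case: ifPn => _; rewrite ?mule0 ?ltry// -EFinB -EFinM ltry.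
Qed.

End EquilibriumStability.

(** * Asymptotic stability of the equilibria *)

Lemma EID_globally_asymptotically_stable (K : realType) (n m p k : nat)
    (Sigma : system K n m p) (V : 'cV[K]_n -> K) (Q : 'M[K]_p)
    (l : 'cV[K]_n -> 'cV[K]_n -> 'cV[K]_k) :
  standing_assumptions Sigma ->
  (forall a, differentiable V a) -> convex_fun V -> strictly_convex V ->
  negative_definite Q ->
  (forall x xb, equilibria Sigma xb ->
     dot (grad V x - grad V xb) (drift Sigma x - drift Sigma xb) =
     dot (outmap Sigma x - outmap Sigma xb)
       (Q *m (outmap Sigma x - outmap Sigma xb)) - enorm (l x xb) ^+ 2) ->
  EI_observable Sigma ->
  forall xb, equilibria Sigma xb ->
    globally_asymptotically_stable Sigma (k_u Sigma xb) xb.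
Proof.
move=> [[_ _ rG] lipf ch fc _] dV Vc Vsc Qneg HM obs xb xbE.
set ub := k_u Sigma xb; pose F a := vfield Sigma a ub.
have Fxb : F xb = 0 by exact: vfield_k_u.
(* The constant input cancels in differences, so the Hill-Moylan identity and the Lipschitz bounds
   on the drift apply to [F]. *)
have FB a b : F a - F b = drift Sigma a - drift Sigma b.
  by rewrite /F /vfield opprD addrACA subrr addr0.
have sol x : trajectory Sigma (cst ub) x -> solves F x.
  exact/trajectory_solves/locally_lipschitz_continuous.
pose D := bregman V xb.
have cD : continuous D by exact: continuous_bregman.
have D0 a : 0 <= D a by exact: bregman_ge0.
pose q a := dot (outmap Sigma a - outmap Sigma xb)
  (Q *m (outmap Sigma a - outmap Sigma xb)).
have q0 a : q a <= 0.
  rewrite /q; have [->|v0] := eqVneq (outmap Sigma a - outmap Sigma xb) 0.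
    by rewrite mulmx0 /dot mulmx0 mxE.
  exact/ltW/Qneg.
have DD x : solves F x -> forall t : K, 0 < t ->
    is_derive t 1 (D \o x) (q (x t) - enorm (l (x t) xb) ^+ 2).
  move=> [_ Dx] t t0; have := is_derive_bregman xb (dV _) (Dx t t0).
  by rewrite -[F (x t)]subr0 -Fxb FB HM.
have Dx x : solves F x -> forall s t, 0 <= s -> s <= t -> D (x t) <= D (x s).
  move=> xs; apply: (derive_le0_nincr _ (DD x xs)) => [|t t0].
    by apply: (cvg_comp _ _ xs.1); exact: cD.
  by rewrite subr_le0 (le_trans (q0 _))// sqr_ge0.
split=> //.
- move=> e e0.
  have [r r0 Dr] : exists2 r, 0 < r & forall a, D a < r -> enorm (a - xb) < e.
    (* The factor [n] converts the sup norm to the Euclidean one; adding 1 keeps the divisor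
       positive in dimension 0. *)
    pose d := e / (n%:R + 1).
    have n1 : 0 < n%:R + 1 :> K by rewrite ltr_wpDl.
    have d0 : 0 < d by rewrite divr_gt0.
    have [r r0 gr] := bregman_growth xb dV Vc Vsc d0.
    exists (r * d); first by rewrite mulr_gt0.
    move=> a Da; have [da|ad] := lerP d `|a - xb|; last first.
      rewrite (le_lt_trans (enorm_le_norm _))//.
      rewrite (@le_lt_trans _ _ ((n%:R + 1) * `|a - xb|)) ?ler_wpM2r ?lerDl//.
      by rewrite mulrC -ltr_pdivlMr.
    by move: Da; rewrite ltNge (le_trans _ (gr _ da))// ler_wpM2l// ltW.
  have [d /= d0 dD] : exists2 d : K, 0 < d & forall a, `|a - xb| < d -> D a < r.
    have : \forall a \near xb, D a < r.
      by apply: (cvgr_lt _ (cD xb)); rewrite /D bregmanxx.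
    move=> /nbhs_ballP[d d0 dD]; exists d => // a ad; apply: dD.
    by rewrite -ball_normE/= distrC.
  exists d => // x /sol xs xd t t0; apply: Dr.
  rewrite (le_lt_trans (Dx _ xs 0 t _ t0))// dD//.
  exact: le_lt_trans (norm_le_enorm _) xd.
- move=> x /sol xs.
  have [r r0 gr] := bregman_growth xb dV Vc Vsc ltr01.
  (* Linear growth bounds the distance on the sublevel set of [D (x 0)] by 1 or by [D (x 0) / r];
     the sum covers both and is positive, so [C] is a neighbourhood of [xb]. *)
  pose rho := 1 + D (x 0) / r; pose C := [set a | `|a - xb| <= rho].
  have subC a : D a <= D (x 0) -> C a.
    move=> Da; rewrite /C /= /rho; have [/gr ra|a1] := lerP 1 `|a - xb|.
      rewrite (@le_trans _ _ (D (x 0) / r)) ?lerDr// ler_pdivlMr//.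
      by rewrite mulrC (le_trans ra).
    by rewrite (le_trans (ltW a1))// lerDl divr_ge0// ltW.
  have cC : compact C by exact: compact_closed_ball_cV.
  have rho0 : 0 < rho by rewrite ltr_wpDr// divr_ge0// ltW.
  have Cxb : nbhs xb C.
    apply: filterS (nbhsx_ballx xb _ rho0) => a.
    by rewrite -ball_normE /C /= distrC => /ltW.
  have [L L0 lipL] := lipschitz_on_compact lipf cC.
  apply: (@lasalle _ _ F C L D) => //.
  - by move=> a b Ca Cb; rewrite FB; exact: lipL.
  - by move=> t t0; apply/subC/Dx.
  - exact: Dx.
  move=> a Da; have [z ztraj za] := fc a _ (L2e_cst ub).
  have zs := sol _ ztraj; exists z; split=> //.
    by move=> t t0; apply: subC; rewrite (le_trans _ Da)// -za Dx.
  (* Constancy of [D] along [z] makes its derivative vanish. That derivative is a sum of two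
     nonpositive terms, so [q (z t) = 0], and definiteness of [Q] gives equal values of [outmap]. *)
  move=> Dz; have hz (t : K) : 0 < t -> outmap Sigma (z t) = outmap Sigma xb.
    move=> t0; have := DD z zs t t0.
    have : is_derive t 1 (D \o z) 0.
      apply: (@near_eq_is_derive _ _ _ (cst (D a))).
      near=> s; rewrite /= Dz// -oppr_le0 ltW//; near: s.
      by apply: Nlt_nbhsl; rewrite oppr_lt0.
    move=> [_ DE0] [_]; rewrite DE0 => /esym/eqP; rewrite subr_eq0 => /eqP qE.
    have qz : q (z t) = 0 by apply/eqP; rewrite eq_le q0 qE sqr_ge0.
    apply/eqP; rewrite -subr_eq0; apply/negP => /negP /Qneg.
    by rewrite -/(q _) qz ltxx.
  (* The derivative says nothing at time 0, which observability includes; right continuity closes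
     the gap. *)
  have hz0 : outmap Sigma (z 0) = outmap Sigma xb.
    have cv : (outmap Sigma \o z) @ 0^'+ --> outmap Sigma (z 0).
      exact: (cvg_comp z (outmap Sigma) zs.1 (ch (z 0))).
    have cvb : (outmap Sigma \o z) @ 0^'+ --> outmap Sigma xb.
      by apply: cvg_near_cst; near=> t; exact: hz.
    exact: (cvg_unique (@norm_hausdorff _ _) cv cvb).
  rewrite -za; apply: (obs xb xbE z ztraj) => // t.
  rewrite le_eqVlt /k_y /output => /predU1P[<-|/hz ->//]; by rewrite hz0.
Unshelve. all: by end_near.
Qed.

Theorem lemma4p3 (K : realType) (n m p : nat) (Sigma : system K n m p)
    (V : 'cV[K]_n -> K) (Q : 'M[K]_p) (S : 'M[K]_(p, m)) (R : 'M[K]_m)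
    (HSigma : standing_assumptions Sigma)
    (HEID : EID_Hill_Moylan Sigma V Q S R)
    (HV : strictly_convex V)
    (HQ : negative_definite Q)
    (Hobs : EI_observable Sigma) :
  (forall xb, equilibria Sigma xb ->
     locally_asymptotically_stable Sigma (k_u Sigma xb) xb) /\
  (strongly_convex V ->
   forall xb, equilibria Sigma xb ->
     globally_asymptotically_stable Sigma (k_u Sigma xb) xb).
Proof.
have [_ _ [dV _] Vc [k [_ [l [_ HM _ _]]]]] := HEID.
have gas := EID_globally_asymptotically_stable HSigma dV Vc HV HQ HM Hobs.
split=> [xb|_ xb] /gas// [xb0 stab attr]; split=> //.
(* Attraction is global, so any radius serves. *)
by exists 1 => // x xt _; exact: attr.
Qed.
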